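(* For every finite system $\mathcal E$ of equations between $\Sigma$-terms, every non-deterministic branch of the computation of $\mathsf{general\_aci}(\mathcal E)$ terminates in a finite amount of time.
   Context: $\Sigma$ contains the constant $\emptyset$, the binary symbol $\cup$, and free function symbols of arbitrary arities. $\mathsf{general\_aci}(\mathcal E)$: $\mathcal E_s:=\emptyset$, $\mathcal E_{ns}:=\mathcal E$; while $\mathcal E_{ns}\ne\emptyset$, remove an arbitrary equation $e$ and act by cases: (1) $X=X$: nothing. (2) $t=X$, $t$ not a variable: add $X=t$. (3) $X=t$ where $t$ can be reordered as $f_1(\bar s_1)\cup\dots\cup f_n(\bar s_n)\cup V_1\cup\dots\cup V_m$ ($f_i\not\equiv\cup$, $V_j$ variables) with $X\in\mathrm{vars}(\bar s_1,\dots,\bar s_n)$: fail. (4) $X=t$, $X$ not in $t$: $\mathcal E_s:=\mathcal E_s[X/t]\wedge(X=t)$, $\mathcal E_{ns}:=\mathcal E_{ns}[X/t]$. (5) $X=t$ where $t$ reorders as $t'\cup X\cup\dots\cup X$ with $t'$ as in (3) and $X\notin\mathrm{vars}(t')$: add $X=t'\cup N$, $N$ new. (6) $f(\bar s)=g(\bar t)$, $f\not\equiv g$: fail. (7) $f(s_1,\dots,s_n)=f(t_1,\dots,t_n)$, $f\not\equiv\cup$: add $s_i=t_i$. (8) $s_1\cup s_2=t_1\cup t_2$: choose a result $\langle\mathcal E'_1,\mathcal E'_2,\theta\rangle$ of $\mathsf{aci\_step}$ on it; $\mathcal E_s:=\mathcal E_s\theta\wedge\mathcal E'_1$, $\mathcal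 E_{ns}:=\mathcal E_{ns}\theta\wedge\mathcal E'_2$. $\mathsf{aci\_step}$ on $f_1(\bar l_1)\cup\dots\cup f_{k_1}(\bar l_{k_1})\cup L_1\cup\dots\cup L_{k_2}=g_1(\bar r_1)\cup\dots\cup g_{h_1}(\bar r_{h_1})\cup R_1\cup\dots\cup R_{h_2}$ ($f_i,g_j\not\equiv\cup$, $L_i,R_j$ variables): (Normalization) introduce new variables $N^L_i$ for $f_i(\bar l_i)$ and $N^R_j$ for $g_j(\bar r_j)$; (Elementary $ACI1$ solution) compute the most general $ACI1$-unifier of $N^L_1\cup\dots\cup N^L_{k_1}\cup L_1\cup\dots\cup L_{k_2}=N^R_1\cup\dots\cup N^R_{h_1}\cup R_1\cup\dots\cup R_{h_2}$, binding each variable to a union of fresh variables $A_{\cdot,\cdot}$; let $\mathcal E^{ACI}_1$ be the bindings of the $L_i,R_j$ and $\mathcal E^{ACI}_2$ the bindings of the $N^L_i,N^R_j$ with these replaced by $f_i(\bar l_i)$, $g_j(\bar r_j)$; (Term propagation, non-deterministic) in a fixed order, for each $A$ occurring in a right-hand side of $\mathcal E^{ACI}_2$, with $f(\bar s)$ the left-hand side of the first equation containing it, set $\lambda(A)=\emptyset$ or $\lambda(A)=f(\bar s)$ and apply immediately; accept only if every equation becomes $f(\bar s)=f_1(\bar s_1)\cup\dots\cup f_h(\bar s_h)$ with $h\ge1$ and all $f_i\equiv f$ (after removing $\emptyset$ and repetitions); $\mathcal E_2$ consists of $\bar s=\bar s_1,\dots,\bar s=\bar s_h$ for each such equation, and $\mathcal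 E_1=\mathcal E^{ACI}_1\lambda$; (Variables removal) from $\mathcal E_1$ take the substitutions $\rho_X$ binding each $L_i,R_j$; with $X\Rightarrow Y$ iff $Y\in\mathrm{vars}(X\rho_X)$, fail if $X\Rightarrow^+X$ for some such $X$, else let $\rho$ be the composition of the $\rho_X$. Return $\langle\mathcal E_1,\mathcal E_2\rho,\rho\rangle$. *)

(* Defs.v *)
From HB Require Import structures.
From mathcomp Require Import all_boot.

Set Implicit Arguments.
Unset Strict Implicit.
Unset Printing Implicit Defensive.

Inductive sym (F : Type) : Type :=
| SEmpty
| SUnion
| SFree of F.

Arguments SEmpty {F}.
Arguments SUnion {F}.

Inductive term (F : Type) : Type :=
| Var of nat
| App of sym F & seq (term F).

Arguments Var {F} _.
Arguments App {F} _ _.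

Notation Emp := (App SEmpty [::]).
Notation Cup s t := (App SUnion [:: s; t]).

Definition sym_enc (F : Type) (f : sym F) : option (option F) :=
  match f with
  | SEmpty => None
  | SUnion => Some None
  | SFree g => Some (Some g)
  end.

Definition sym_dec (F : Type) (o : option (option F)) : sym F :=
  match o with
  | None => SEmpty
  | Some None => SUnion
  | Some (Some g) => SFree g
  end.

Lemma sym_encK (F : Type) : cancel (@sym_enc F) (@sym_dec F).
Proof. by case. Qed.

Fixpoint term_enc (F : Type) (t : term F) : GenTree.tree (nat + sym F) :=
  match t with
  | Var x => GenTree.Leaf (inl x)
  | App f ts => GenTree.Node 0 (GenTree.Leaf (inr f) :: map (@term_enc F) ts)
  end.

Fixpoint term_dec (F : Type) (g : GenTree.tree (nat + sym F)) : term F :=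
  match g with
  | GenTree.Leaf (inl x) => Var x
  | GenTree.Node _ (GenTree.Leaf (inr f) :: gs) => App f (map (@term_dec F) gs)
  | _ => Var 0
  end.

Lemma term_encK (F : Type) : cancel (@term_enc F) (@term_dec F).
Proof.
rewrite /cancel; fix IH 1; case=> [x|f ts] //=; congr (App f _).
by elim: ts => //= t ts ->; rewrite IH.
Qed.

HB.instance Definition _ (F : eqType) :=
  Equality.copy (sym F) (can_type (@sym_encK F)).
HB.instance Definition _ (F : eqType) :=
  Equality.copy (term F) (can_type (@term_encK F)).

Definition sym_arity (F : Type) (ar : F -> nat) (f : sym F) : nat :=
  match f with
  | SEmpty => 0
  | SUnion => 2
  | SFree g => ar g
  end.

Fixpoint wf_term (F : Type) (ar : F -> nat) (t : term F) : bool :=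
  match t with
  | Var _ => true
  | App f ts => (size ts == sym_arity ar f) && all (wf_term ar) ts
  end.

Definition equation (F : Type) : Type := (term F * term F)%type.

Definition wf_equation (F : Type) (ar : F -> nat) (e : equation F) : bool :=
  wf_term ar e.1 && wf_term ar e.2.

Fixpoint vars (F : Type) (t : term F) : seq nat :=
  match t with
  | Var x => [:: x]
  | App _ ts => flatten (map (@vars F) ts)
  end.

Definition equation_vars (F : Type) (e : equation F) : seq nat := vars e.1 ++ vars e.2.

Fixpoint subst (F : Type) (th : nat -> term F) (t : term F) : term F :=
  match t with
  | Var x => th x
  | App f ts => App f (map (subst th) ts)
  end.

Definition subst_equations (F : Type) (th : nat -> term F) (E : seq (equation F)) :
  seq (equation F) := [seq (subst th e.1, subst th e.2) | e <- E].

Definition single (F : Type) (X : nat) (t : term F) : nat -> term F :=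
  fun y => if y == X then t else Var y.

Definition is_var (F : Type) (t : term F) : bool :=
  if t is Var _ then true else false.

Definition same_head (F : eqType) (s t : term F) : bool :=
  match s, t with
  | App f _, App g _ => f == g
  | _, _ => false
  end.

Definition args (F : Type) (t : term F) : seq (term F) :=
  if t is App _ ts then ts else [::].

(* The list of the t_i when t is a union t_1 U ... U t_n of terms whose root  *)
(* is not U; this is t reordered up to associativity of U. The constant Emp   *)
(* is a component like any other constant.                                    *)
Fixpoint comps (F : Type) (t : term F) : seq (term F) :=
  match t with
  | Cup s1 s2 => comps s1 ++ comps s2
  | _ => [:: t]
  end.

Definition fparts (F : Type) (t : term F) : seq (term F) :=
  [seq u <- comps t | ~~ is_var u].

Definition vparts (F : Type) (t : term F) : seq nat :=
  pmap (fun u : term F => if u is Var x then Some x else None) (comps t).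

Fixpoint cupl (F : Type) (ts : seq (term F)) : term F :=
  match ts with
  | [::] => Emp
  | [:: t] => t
  | t :: ts' => Cup t (cupl ts')
  end.

Inductive aci1 (F : Type) : term F -> term F -> Prop :=
| aci1_refl t : aci1 t t
| aci1_sym s t : aci1 s t -> aci1 t s
| aci1_trans s t u : aci1 s t -> aci1 t u -> aci1 s u
| aci1_cong f p s t q : aci1 s t -> aci1 (App f (p ++ s :: q)) (App f (p ++ t :: q))
| aci1_assoc s t u : aci1 (Cup s (Cup t u)) (Cup (Cup s t) u)
| aci1_comm s t : aci1 (Cup s t) (Cup t s)
| aci1_idem t : aci1 (Cup t t) t
| aci1_unit t : aci1 (Cup t Emp) t.

Definition aci1_unifier (F : Type) (th : nat -> term F) (s t : term F) : Prop :=
  aci1 (subst th s) (subst th t).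

Definition aci1_mgu (F : Type) (th : nat -> term F) (s t : term F) : Prop :=
  aci1_unifier th s t /\
  forall ta : nat -> term F, aci1_unifier ta s t ->
    exists de : nat -> term F,
      forall x, x \in vars s ++ vars t -> aci1 (subst de (th x)) (ta x).

Definition var_union (F : Type) (As : seq nat) : term F := cupl (map Var As).

(* NL and NR are the variables standing for the non-variable components of s  *)
(* and t; mu x lists the fresh variables A whose union is bound to x; U is    *)
(* the list of all the variables used so far.                                 *)
Definition elementary_solution (F : eqType) (U : seq nat) (s t : term F)
    (NL NR : seq nat) (mu : nat -> seq nat) : Prop :=
  [/\ size NL = size (fparts s),
      size NR = size (fparts t),
      uniq (NL ++ NR) /\ (forall N, N \in NL ++ NR -> N \notin U),
      aci1_mgu (fun x => var_union F (mu x))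
        (var_union F (NL ++ vparts s)) (var_union F (NR ++ vparts t))
    & forall x A, x \in (NL ++ vparts s) ++ (NR ++ vparts t) ->
        A \in mu x -> A \notin U ++ NL ++ NR].

Definition new_vars (F : eqType) (s t : term F) (NL NR : seq nat)
    (mu : nat -> seq nat) : seq nat :=
  NL ++ NR ++ flatten (map mu ((NL ++ vparts s) ++ (NR ++ vparts t))).

(* The bindings of the N's, each N being replaced by the term it stands for.  *)
(* A pair (u, As) is the equation u = union of the variables in As.           *)
Definition aci_eqs2 (F : eqType) (s t : term F) (NL NR : seq nat)
    (mu : nat -> seq nat) : seq (term F * seq nat) :=
  zip (fparts s ++ fparts t) (map mu (NL ++ NR)).

Definition top_vars (F : eqType) (s t : term F) : seq nat :=
  undup (vparts s ++ vparts t).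

Definition first_lhs (F : eqType) (eqs : seq (term F * seq nat)) (A : nat) :
  term F := (nth (Emp, [::]) eqs (find (fun q => A \in q.2) eqs)).1.

(* The A's do not occur in left-hand sides, so that making the choices one    *)
(* after the other and applying each of them immediately amounts to a         *)
(* simultaneous substitution lam.                                             *)
Definition propagation (F : eqType) (eqs : seq (term F * seq nat))
    (lam : nat -> term F) : Prop :=
  forall A, if A \in flatten (unzip2 eqs)
            then lam A = Emp \/ lam A = first_lhs eqs A
            else lam A = Var A.

(* The components of a union once Emp and repetitions are removed; a union    *)
(* with no other component than Emp reduces to Emp.                           *)
Definition reduce (F : eqType) (us : seq (term F)) : seq (term F) :=
  if undup [seq u <- us | u != Emp] is u :: us' then u :: us' else [:: Emp].

Definition accepted (F : eqType) (eqs : seq (term F * seq nat))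
    (lam : nat -> term F) : bool :=
  all (fun q => all (same_head q.1) (reduce (map lam q.2))) eqs.

Definition decompose (F : eqType) (eqs : seq (term F * seq nat))
    (lam : nat -> term F) : seq (equation F) :=
  flatten [seq flatten [seq zip (args q.1) (args u) | u <- reduce (map lam q.2)]
          | q <- eqs].

Definition binding (F : Type) (mu : nat -> seq nat) (lam : nat -> term F)
    (X : nat) : term F := subst lam (var_union F (mu X)).

Definition aci_eqs1 (F : eqType) (s t : term F) (mu : nat -> seq nat)
    (lam : nat -> term F) : seq (equation F) :=
  [seq (Var X, binding mu lam X) | X <- top_vars s t].

Definition depends (F : eqType) (s t : term F) (mu : nat -> seq nat)
    (lam : nat -> term F) : rel nat :=
  fun X Y => (X \in top_vars s t) && (Y \in vars (binding mu lam X)).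

Definition cyclic_dep (e : rel nat) : Prop :=
  exists X, exists p, path e X (rcons p X).

(* The substitution that applies the bindings of the variables of o one after *)
(* the other, from left to right.                                             *)
Definition compose (F : Type) (rho : nat -> term F) (o : seq nat) :
  nat -> term F :=
  fun x => foldl (fun u X => subst (single X (rho X)) u) (Var x) o.

Inductive aci_result (F : Type) : Type :=
| AciFail
| AciDone of seq nat & seq (equation F) & seq (equation F) & (nat -> term F).

Arguments AciFail {F}.

(* AciDone V E1 E2 rho: V lists the variables introduced by the step. In      *)
(* aci_done, the single bindings are composed in an order o compatible with   *)
(* the dependency relation, so that rho eliminates all the top variables.     *)
Inductive aci_step (F : eqType) (U : seq nat) (s t : term F) :
    aci_result F -> Prop :=
| aci_rejected NL NR mu lam :
    elementary_solution U s t NL NR mu ->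
    propagation (aci_eqs2 s t NL NR mu) lam ->
    ~~ accepted (aci_eqs2 s t NL NR mu) lam ->
    aci_step U s t AciFail
| aci_cyclic NL NR mu lam :
    elementary_solution U s t NL NR mu ->
    propagation (aci_eqs2 s t NL NR mu) lam ->
    accepted (aci_eqs2 s t NL NR mu) lam ->
    cyclic_dep (depends s t mu lam) ->
    aci_step U s t AciFail
| aci_done NL NR mu lam o :
    elementary_solution U s t NL NR mu ->
    propagation (aci_eqs2 s t NL NR mu) lam ->
    accepted (aci_eqs2 s t NL NR mu) lam ->
    ~ cyclic_dep (depends s t mu lam) ->
    perm_eq o (top_vars s t) ->
    pairwise (fun X Y => ~~ depends s t mu lam Y X) o ->
    let rho := compose (binding mu lam) o in
    aci_step U s t
      (AciDone (new_vars s t NL NR mu)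
         (aci_eqs1 s t mu lam)
         (subst_equations rho (decompose (aci_eqs2 s t NL NR mu) lam))
         rho).

(* Run U Es Ens: U lists the variables used so far in the computation, so     *)
(* that a variable is new when it is not in U.                                *)
Inductive config (F : Type) : Type :=
| Failed
| Run of seq nat & seq (equation F) & seq (equation F).

Arguments Failed {F}.

(* handle U Es Ens e c: the equation e having been removed from the unsolved  *)
(* equations, which leaves Ens, processing e leads to c.                      *)
Inductive handle (F : eqType) (U : seq nat) (Es Ens : seq (equation F)) :
    equation F -> config F -> Prop :=
| h_trivial X :
    handle U Es Ens (Var X, Var X) (Run U Es Ens)
| h_swap t X :
    ~~ is_var t ->
    handle U Es Ens (t, Var X) (Run U Es ((Var X, t) :: Ens))
| h_occurs X t :
    X \in flatten (map (@vars F) (fparts t)) ->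
    handle U Es Ens (Var X, t) Failed
| h_subst X t :
    X \notin vars t ->
    handle U Es Ens (Var X, t)
      (Run U ((Var X, t) :: subst_equations (single X t) Es)
             (subst_equations (single X t) Ens))
| h_remove X t N :
    ~~ is_var t ->
    X \in vparts t ->
    X \notin flatten (map (@vars F) (fparts t)) ->
    N \notin U ->
    let t' := cupl (fparts t ++ [seq Var V | V <- vparts t & V != X]) in
    handle U Es Ens (Var X, t) (Run (N :: U) Es ((Var X, Cup t' (Var N)) :: Ens))
| h_clash f g ss ts :
    f != g ->
    handle U Es Ens (App f ss, App g ts) Failed
| h_decomp f ss ts :
    f != SUnion ->
    handle U Es Ens (App f ss, App f ts) (Run U Es (zip ss ts ++ Ens))
| h_aci_fail s1 s2 t1 t2 :
    aci_step U (Cup s1 s2) (Cup t1 t2) AciFail ->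
    handle U Es Ens (Cup s1 s2, Cup t1 t2) Failed
| h_aci s1 s2 t1 t2 V E1 E2 th :
    aci_step U (Cup s1 s2) (Cup t1 t2) (AciDone V E1 E2 th) ->
    handle U Es Ens (Cup s1 s2, Cup t1 t2)
      (Run (V ++ U) (E1 ++ subst_equations th Es) (E2 ++ subst_equations th Ens)).

Inductive general_aci_step (F : eqType) : config F -> config F -> Prop :=
| general_aci_select U Es p e q c :
    handle U Es (p ++ q) e c ->
    general_aci_step (Run U Es (p ++ e :: q)) c.

Definition general_aci_init (F : eqType) (E : seq (equation F)) : config F :=
  Run (flatten (map (@equation_vars F) E)) [::] E.

Definition infinite_branch (F : eqType) (E : seq (equation F))
    (c : nat -> config F) : Prop :=
  c 0 = general_aci_init E /\ forall n, general_aci_step (c n) (c n.+1).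

(* Main.v *)
(* Every non-union subterm met during a computation is an instance, under the *)
(* substitution accumulated so far, of a subterm of the initial system. Let T *)
(* be the list of the current instances of these initial subterms. Along a    *)
(* branch of a term the non-union subterms are pairwise distinct elements of  *)
(* T, so the depth of a term, not counting unions, never exceeds the constant *)
(* size of T, although unions may become wider and wider. Depths of elements  *)
(* of T can only grow under substitution, hence they change finitely often.   *)
(* While they do not change, an equation is either deleted, or replaced by    *)
(* equations of smaller depth, or rearranged by one of the two rules "swap"   *)
(* and "remove", which only finitely often follow each other. A lexicographic *)
(* measure combines these facts.                                              *)

Require Import Defs.
From mathcomp Require Import all_boot.

Set Implicit Arguments.
Unset Strict Implicit.
Unset Printing Implicit Defensive.

(** Sizes of equations do not decrease, since ACI steps copy terms and fresh variables widen unions.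
    What stays bounded is the nesting of non-union symbols. A list [T] of constant length is
    instantiated by every substitution, and all non-union subterms of the unsolved equations, with
    their arguments, belong to it. A term is at most as deep as it has distinct nodes
    ([depth_leq_nodes]), so depths in [T] never exceed [size T] ([closed_depth]).

    Hence the slack, the total distance of the depths in [T] from that bound, never increases, and
    when it stays equal no depth in [T] has changed ([slack_subst]). Equation depths are then
    unchanged too, and replacing an equation by shallower ones lowers the multiset of depths
    ([lexlt_measure]). Swapping sides and removing [X] keep depths and lower a flag
    ([lexlt_measure_flag]). [inv_eliminate] and [inv_rework] handle these two kinds of rules,
    [loop_inv_step] assigns each rule to one of them, and well-foundedness of [lexlt] excludes
    infinite branches. *)

(** * Nodes and depth of terms *)

Lemma term_seq_ind (F : eqType) (P : term F -> Prop) :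
  (forall x, P (Var x)) ->
  (forall f ts, (forall t, t \in ts -> P t) -> P (App f ts)) ->
  forall t, P t.
Proof.
move=> HV HA; fix IH 1; case=> [x|f ts]; first exact: HV.
apply: HA; elim: ts => [|a ts IHts] t.
  by move/notF; apply: False_ind.
rewrite in_cons; case: (t =P a) => [-> _|_ t_ts]; first exact: IH.
exact: IHts t_ts.
Qed.

Definition is_cup (F : Type) (f : sym F) (ts : seq (term F)) : bool :=
  if f is SUnion then size ts == 2 else false.

(** Unions are skipped, so that these subterms can stay in a fixed list while unions keep
    widening. *)
Fixpoint nodes (F : Type) (t : term F) : seq (term F) :=
  match t with
  | Var _ => [::]
  | App f ts =>
      let us := flatten (map (@nodes F) ts) in
      if is_cup f ts then us else t :: us
  end.

(* Constants have depth 0, so that the unit of the union is as shallow as a   *)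
(* variable.                                                                  *)
Fixpoint depth (F : Type) (t : term F) : nat :=
  match t with
  | Var _ => 0
  | App f ts => foldr maxn 0 (map (fun a => depth a + ~~ is_cup f ts) ts)
  end.

Lemma is_cup_map (F : Type) (f : sym F) (h : term F -> term F) ts :
  is_cup f (map h ts) = is_cup f ts.
Proof. by case: f => //=; rewrite size_map. Qed.

Lemma depth_App (F : eqType) (f : sym F) ts :
  depth (App f ts) = \max_(a <- ts) (depth a + ~~ is_cup f ts).
Proof. by rewrite /= foldrE big_map. Qed.

Lemma depth_Cup (F : eqType) (s t : term F) :
  depth (Cup s t) = maxn (depth s) (depth t).
Proof. by rewrite /= !addn0 maxn0. Qed.

Lemma depth_arg (F : eqType) (f : sym F) ts a :
  a \in ts -> depth a + ~~ is_cup f ts <= depth (App f ts).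
Proof.
move=> a_ts; rewrite depth_App.
by apply: (@leq_bigmax_seq _ _ _ (fun a => depth a + _)).
Qed.

Lemma depth_AppP (F : eqType) (f : sym F) ts m :
  (forall a, a \in ts -> depth a + ~~ is_cup f ts <= m) ->
  depth (App f ts) <= m.
Proof. by move=> H; rewrite depth_App; apply/bigmax_leqP_seq => a /H. Qed.

Lemma depth_subst (F : eqType) (th : nat -> term F) t :
  depth t <= depth (subst th t).
Proof.
elim/term_seq_ind: t => // f ts IH; apply: depth_AppP => a a_ts.
apply: leq_trans (depth_arg f (map_f (subst th) a_ts)).
by rewrite is_cup_map leq_add2r IH.
Qed.

Lemma mem_nodes_App (F : eqType) (f : sym F) ts v :
  v \in nodes (App f ts) ->
  (~~ is_cup f ts /\ v = App f ts) \/ (exists2 a, a \in ts & v \in nodes a).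
Proof.
have flat : v \in flatten (map (@nodes F) ts) ->
    exists2 a, a \in ts & v \in nodes a by move=> /flatten_mapP.
rewrite /=; case: ifP => cf; first by right; apply: flat.
by rewrite inE => /orP[/eqP->|?]; [left | right; apply: flat].
Qed.

Lemma nodes_arg (F : eqType) (f : sym F) ts a :
  a \in ts -> {subset nodes a <= nodes (App f ts)}.
Proof.
move=> a_ts v v_a; have v_ts : v \in flatten (map (@nodes F) ts).
  by apply/flatten_mapP; exists a.
by rewrite /=; case: ifP; rewrite // inE v_ts orbT.
Qed.

Lemma vars_arg (F : eqType) (f : sym F) (ts : seq (term F)) a :
  a \in ts -> {subset vars a <= vars (App f ts)}.
Proof. by move=> a_ts x x_a; apply/flatten_mapP; exists a. Qed.

Lemma nodes_App (F : eqType) (t v : term F) :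
  v \in nodes t -> exists f ts, v = App f ts /\ ~~ is_cup f ts.
Proof.
elim/term_seq_ind: t => // f ts IH /mem_nodes_App[[nc ->]|[a a_ts]].
  by exists f, ts.
exact: IH.
Qed.

Lemma vars_nodes (F : eqType) (t v : term F) :
  v \in nodes t -> {subset vars v <= vars t}.
Proof.
elim/term_seq_ind: t => // f ts IH /mem_nodes_App[[nc ->] //|[a a_ts v_a]].
by move=> x /(IH a a_ts v_a); apply: vars_arg.
Qed.

Lemma depth_nodes (F : eqType) (t v : term F) :
  v \in nodes t -> depth v <= depth t.
Proof.
elim/term_seq_ind: t => // f ts IH /mem_nodes_App[[nc ->] //|[a a_ts v_a]].
apply: leq_trans (IH _ a_ts v_a) (leq_trans _ (depth_arg f a_ts)).
exact: leq_addr.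
Qed.

Lemma vars_node_arg (F : eqType) (t v a : term F) :
  v \in nodes t -> a \in args v -> {subset vars a <= vars t}.
Proof.
move=> v_t; case: (nodes_App v_t) => f [ts [vE _]]; rewrite vE => a_ts x x_a.
by apply: (vars_nodes v_t); rewrite vE; apply: vars_arg a_ts _ x_a.
Qed.

Lemma depth_node_arg (F : eqType) (t v a : term F) :
  v \in nodes t -> a \in args v -> depth a < depth t.
Proof.
move=> v_t; case: (nodes_App v_t) => f [ts [vE nc]]; rewrite vE => a_ts.
apply: leq_trans (depth_nodes v_t); rewrite vE.
by apply: leq_trans (depth_arg f a_ts); rewrite nc addn1.
Qed.

(** A non-union node is strictly deeper than its arguments, so it does not reappear below itself and
    each level of nesting adds a distinct node. *)
Lemma depth_leq_nodes (F : eqType) (t : term F) :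
  depth t <= size (undup (nodes t)).
Proof.
elim/term_seq_ind: t => // f ts IH; apply: depth_AppP => a a_ts.
case cf: (is_cup f ts) => /=.
  rewrite addn0; apply: leq_trans (IH a a_ts) _.
  apply: uniq_leq_size (undup_uniq _) _ => v.
  by rewrite !mem_undup => /(nodes_arg f a_ts).
have root_a : App f ts \notin nodes a.
  apply/negP => /depth_nodes; rewrite leqNgt => /negP[].
  by apply: leq_trans (depth_arg f a_ts); rewrite cf addn1.
rewrite addn1; apply: (@leq_trans (size (App f ts :: undup (nodes a)))).
  by rewrite ltnS IH.
apply: uniq_leq_size => [|v]; first by rewrite /= mem_undup root_a undup_uniq.
rewrite inE mem_undup => /orP[/eqP->|/(nodes_arg f a_ts)]; last first.
  by rewrite mem_undup.
by rewrite mem_undup /= cf mem_head.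
Qed.

(** * Substitutions *)

Lemma nodes_subst (F : eqType) (th : nat -> term F) t v :
  v \in nodes (subst th t) ->
  (exists2 w, w \in nodes t & v = subst th w) \/
  (exists2 x, x \in vars t & v \in nodes (th x)).
Proof.
elim/term_seq_ind: t => [x v_x|f ts IH]; first by right; exists x; rewrite ?inE.
move/mem_nodes_App => [[nc ->]|[_ /mapP[a a_ts ->] /(IH a a_ts)]].
  left; exists (App f ts) => //=.
  by rewrite is_cup_map in nc; rewrite (negbTE nc) mem_head.
case=> [[w w_a ->]|[x x_a v_x]]; [left; exists w | right; exists x] => //.
  exact: nodes_arg a_ts _ w_a.
exact: vars_arg a_ts _ x_a.
Qed.

Lemma vars_subst (F : eqType) (th : nat -> term F) t x :
  x \in vars (subst th t) -> exists2 y, y \in vars t & x \in vars (th y).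
Proof.
elim/term_seq_ind: t => [y x_y|f ts IH]; first by exists y; rewrite ?inE.
move=> /flatten_mapP[_ /mapP[a a_ts ->] /(IH a a_ts)[y y_a x_y]].
by exists y => //; apply: vars_arg a_ts _ y_a.
Qed.

Lemma subst_fixed (F : eqType) (th : nat -> term F) t :
  (forall x, x \in vars t -> th x = Var x) -> subst th t = t.
Proof.
elim/term_seq_ind: t => [x|f ts IH] H /=; first by apply: H; rewrite inE.
congr App; apply: map_id_in => a a_ts; apply: IH => // x x_a.
by apply: H; apply: vars_arg a_ts _ x_a.
Qed.

Lemma subst_single_fresh (F : eqType) X (t u : term F) :
  X \notin vars u -> subst (single X t) u = u.
Proof.
move=> XNu; apply: subst_fixed => x x_u; rewrite /single.
by case: eqP => // xX; rewrite -xX x_u in XNu.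
Qed.

Lemma subst_comp (F : eqType) (th ta : nat -> term F) t :
  subst ta (subst th t) = subst (fun x => subst ta (th x)) t.
Proof.
elim/term_seq_ind: t => //= f ts IH; congr App; rewrite -map_comp.
by apply/eq_in_map => a /IH.
Qed.

(** * Components of unions *)

Lemma comps_App (F : eqType) (f : sym F) ts :
  comps (App f ts) =
  if is_cup f ts then flatten (map (@comps F) ts) else [:: App f ts].
Proof. by case: f => //; case: ts => [|a [|b [|c ts]]] //=; rewrite cats0. Qed.

Lemma comps_nodes (F : eqType) (t u : term F) :
  u \in comps t -> ~~ is_var u -> u \in nodes t.
Proof.
elim/term_seq_ind: t => [x|f ts IH]; first by rewrite inE => /eqP->.
rewrite comps_App /=; case: ifP => cf.
  move=> /flatten_mapP[a a_ts u_a] nu; apply/flatten_mapP; exists a => //.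
  exact: IH.
by rewrite inE => /eqP-> _; rewrite mem_head.
Qed.

Lemma fparts_nodes (F : eqType) (t : term F) : {subset fparts t <= nodes t}.
Proof. by move=> u; rewrite mem_filter => /andP[nu /comps_nodes->]. Qed.

Lemma comps_sub (F : eqType) (t u : term F) :
  u \in comps t -> {subset nodes u <= nodes t} /\ {subset vars u <= vars t}.
Proof.
elim/term_seq_ind: t => [x|f ts IH]; first by rewrite inE => /eqP->; split.
rewrite comps_App; case: ifP => cf; last by rewrite inE => /eqP->; split.
move=> /flatten_mapP[a a_ts /(IH a a_ts)[nu vu]]; split=> v.
  by move/nu; apply: nodes_arg.
by move/vu; apply: vars_arg.
Qed.

Lemma mem_vparts (F : eqType) (t : term F) X :
  (X \in vparts t) = (Var X \in comps t).
Proof.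
rewrite mem_pmap; apply/mapP/idP => [[[x|//] x_t [->]] //|X_t].
by exists (Var X).
Qed.

Lemma vparts_vars (F : eqType) (t : term F) : {subset vparts t <= vars t}.
Proof. by move=> X; rewrite mem_vparts => /comps_sub[_]; apply; rewrite inE. Qed.

Lemma depth_subst_comps (F : eqType) (th : nat -> term F) t :
  depth (subst th t) = \max_(u <- comps t) depth (subst th u).
Proof.
elim/term_seq_ind: t => [x|f ts IH]; first by rewrite big_seq1.
rewrite comps_App; case: ifP => cf; last by rewrite big_seq1.
rewrite depth_App is_cup_map cf big_map big_flatten big_map.
by apply: eq_big_seq => a /IH->; rewrite addn0.
Qed.

Lemma depth_subst_cupl (F : eqType) (th : nat -> term F) us :
  depth (subst th (cupl us)) = \max_(u <- us) depth (subst th u).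
Proof.
elim: us => [|u [|w us] IH]; rewrite ?big_nil ?big_seq1 //.
by rewrite big_cons -IH [LHS]depth_Cup.
Qed.

Lemma nodes_cupl (F : eqType) (us : seq (term F)) v :
  v \in nodes (cupl us) -> v = Emp \/ exists2 u, u \in us & v \in nodes u.
Proof.
elim: us => [|u [|w us] IH]; first by rewrite inE => /eqP->; left.
  by move=> v_u; right; exists u; rewrite ?mem_head.
move/mem_nodes_App => [[//]|[a]]; rewrite !inE.
move=> /orP[/eqP->|/eqP->] v_a; first by right; exists u; rewrite ?mem_head.
case: (IH v_a) => [->|[a' a_us v_a']]; [by left | right; exists a' => //].
by rewrite inE a_us orbT.
Qed.

Lemma vars_cupl (F : eqType) (us : seq (term F)) x :
  x \in vars (cupl us) -> exists2 u, u \in us & x \in vars u.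
Proof.
elim: us => [|u [|w us] IH] //; first by move=> ?; exists u; rewrite ?mem_head.
move=> /flatten_mapP[a]; rewrite !inE.
move=> /orP[/eqP->|/eqP->] x_a; first by exists u; rewrite ?mem_head.
by case: (IH x_a) => a' a_us x_a'; exists a'; rewrite // inE a_us orbT.
Qed.

Lemma subst_cupl (F : eqType) (th : nat -> term F) us :
  subst th (cupl us) = cupl (map (subst th) us).
Proof. by elim: us => [|u [|w us] IH] //=; rewrite /= in IH; rewrite IH. Qed.

Lemma binding_cupl (F : eqType) (mu : nat -> seq nat) (lam : nat -> term F) X :
  binding mu lam X = cupl (map lam (mu X)).
Proof. by rewrite /binding /var_union subst_cupl -map_comp. Qed.

(** * Lists of terms closed under nodes *)

(** Arguments are included because decomposition makes them sides of new equations; they may be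
    variables or unions, hence not nodes. *)
Definition covered (F : eqType) (T : seq (term F)) (t : term F) : Prop :=
  forall v, v \in nodes t -> v \in T /\ {subset args v <= T}.

Definition node_closed (F : eqType) (T : seq (term F)) : Prop :=
  forall u, u \in T -> covered T u.

Lemma closed_depth (F : eqType) (T : seq (term F)) u :
  node_closed T -> u \in T -> depth u <= size T.
Proof.
move=> clT uT; apply: leq_trans (depth_leq_nodes u) _.
apply: uniq_leq_size (undup_uniq _) _ => v.
by rewrite mem_undup => /(clT u uT)[].
Qed.

Lemma covered_fresh (F : eqType) (T : seq (term F)) X t u :
  covered T u -> X \notin vars u -> covered (map (subst (single X t)) T) u.
Proof.
move=> cu XNu v v_u; have [vT aT] := cu v v_u; split=> [|a a_v].
  apply/mapP; exists v => //; rewrite subst_single_fresh //.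
  by apply: contra XNu; apply: vars_nodes v_u _.
apply/mapP; exists a; first exact: aT.
by rewrite subst_single_fresh //; apply: contra XNu; apply: vars_node_arg v_u a_v _.
Qed.

(** A node of the instance is the image of a node of [u], or a node of [t]; the latter is fixed by
    the substitution because [X] does not occur in [t]. *)
Lemma covered_single (F : eqType) (T : seq (term F)) X t u :
  covered T t -> X \notin vars t -> covered T u ->
  covered (map (subst (single X t)) T) (subst (single X t) u).
Proof.
move=> ct XNt cu v /nodes_subst[[w w_u ->]|[x x_u]].
  have [wT aT] := cu w w_u; split; first exact: map_f.
  have [f [ts [wE _]]] := nodes_App w_u; rewrite wE in aT *.
  move=> _ /mapP[a a_ts ->].
  by apply: map_f; apply: aT.
by rewrite /single; case: eqP => // _; apply: covered_fresh.
Qed.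

(** * Successive elimination of variables *)

Lemma subst_compose (F : eqType) (b : nat -> term F) o u :
  subst (compose b o) u = foldl (fun u X => subst (single X (b X)) u) u o.
Proof.
elim/term_seq_ind: u => // f ts IH; rewrite /=.
have -> : map (subst (compose b o)) ts =
    [seq foldl (fun u X => subst (single X (b X)) u) a o | a <- ts].
  exact/eq_in_map.
elim: o ts {IH} => [|X o IHo] ts /=; first by rewrite map_id.
by rewrite -IHo -map_comp.
Qed.

Lemma subst_compose_cons (F : eqType) (b : nat -> term F) X o u :
  subst (compose b (X :: o)) u = subst (compose b o) (subst (single X (b X)) u).
Proof. by rewrite !subst_compose. Qed.

Lemma subst_compose_nil (F : eqType) (b : nat -> term F) u :
  subst (compose b [::]) u = u.
Proof. by rewrite subst_compose. Qed.

Lemma compose_fixed (F : eqType) (b : nat -> term F) o N :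
  N \notin o -> compose b o N = Var N.
Proof.
rewrite /compose; elim: o => //= X o IH; rewrite inE negb_or => /andP[NX No].
by rewrite /single (negbTE NX) IH.
Qed.

Lemma vars_compose (F : eqType) (b : nat -> term F) o u x :
  x \in vars (subst (compose b o) u) ->
  x \in vars u \/ exists2 X, X \in o & x \in vars (b X).
Proof.
elim: o u => [|X o IH] u; first by rewrite subst_compose_nil; left.
rewrite subst_compose_cons => /IH[/vars_subst[y y_u]|[Y Yo xY]].
  rewrite /single; case: eqP => [_ ?|_]; first by right; exists X; rewrite ?mem_head.
  by rewrite inE => /eqP->; left.
by right; exists Y; rewrite // inE Yo orbT.
Qed.

(** A binding contains neither its own variable nor one eliminated earlier, so an eliminated
    variable never returns. *)
Definition triangular (F : eqType) (T : seq (term F)) (b : nat -> term F)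
    (o : seq nat) : Prop :=
  [/\ pairwise (fun X Y => X \notin vars (b Y)) o,
      forall X, X \in o -> X \notin vars (b X)
    & forall X, X \in o -> covered T (b X)].

Lemma triangular_behead (F : eqType) (T : seq (term F)) b X o :
  triangular T b (X :: o) ->
  triangular (map (subst (single X (b X))) T) b o.
Proof.
case=> /= /andP[/allP Xo pw] irr cov; split=> // Y Yo.
  by apply: irr; rewrite inE Yo orbT.
by apply: covered_fresh; [apply: cov; rewrite inE Yo orbT | apply: Xo].
Qed.

Lemma covered_compose (F : eqType) (T : seq (term F)) b o u :
  triangular T b o -> covered T u ->
  covered (map (subst (compose b o)) T) (subst (compose b o) u).
Proof.
elim: o T u => [|X o IH] T u tri cu.
  by rewrite subst_compose_nil (eq_map (subst_compose_nil b)) map_id.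
rewrite subst_compose_cons (eq_map (subst_compose_cons b X o)).
rewrite (map_comp (subst (compose b o))); apply: IH; first exact: triangular_behead.
by case: tri => _ irr cov; apply: covered_single; rewrite ?irr ?mem_head //;
  apply: cov; rewrite mem_head.
Qed.

Lemma closed_compose (F : eqType) (T : seq (term F)) b o :
  triangular T b o -> node_closed T -> node_closed (map (subst (compose b o)) T).
Proof.
by move=> tri clT _ /mapP[u uT ->]; apply: covered_compose => //; apply: clT.
Qed.

(** * The lexicographic order *)

(** The size test relates only lists of equal length; without it the order would not be
    well-founded. *)
Fixpoint lexlt (s t : seq nat) : bool :=
  match s, t with
  | x :: s', y :: t' =>
      (x < y) && (size s' == size t') || (x == y) && lexlt s' t'
  | _, _ => false
  end.

Lemma lexlt_size s t : lexlt s t -> size s = size t.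
Proof.
elim: s t => [|x s IH] [|y t] //= /orP[/andP[_ /eqP->] //|/andP[_ /IH->]] //.
Qed.

Lemma lexlt_wf s : Acc lexlt s.
Proof.
have [n] : exists n, size s = n by exists (size s).
elim: n s => [|n IH] s.
  by move/size0nil=> ->; constructor; case.
case: s => [//|x s] [sz].
elim/ltn_ind: x s sz => x IHx s sz.
have accs := IH s sz.
elim: accs sz => {}s _ IHs sz; constructor=> -[//|y t] /= /orP[].
  by case/andP=> yx /eqP st; apply: IHx; rewrite ?st.
by case/andP=> /eqP-> ts; apply: IHs; rewrite // (lexlt_size ts).
Qed.

Lemma lexlt_cat2l s a b : lexlt a b -> lexlt (s ++ a) (s ++ b).
Proof. by move=> ab; elim: s => //= x s ->; rewrite eqxx orbT. Qed.

Lemma lexlt_map (f g : nat -> nat) s1 x s2 a b :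
  {in s1, f =1 g} -> f x < g x -> size a = size b ->
  lexlt (map f (s1 ++ x :: s2) ++ a) (map g (s1 ++ x :: s2) ++ b).
Proof.
move=> fg fgx ab; rewrite !map_cat -!catA.
have /eq_in_map-> := fg.
by apply: lexlt_cat2l; rewrite /= fgx !size_cat !size_map ab eqxx.
Qed.

(** * The measure *)

Definition edepth (F : Type) (e : equation F) : nat :=
  maxn (depth e.1) (depth e.2).

(* Decreased by the two rules that only rearrange an equation.                *)
Definition flag (F : eqType) (e : equation F) : nat :=
  match e with
  | (Var _, Var _) => 0
  | (Var X, t) => X \in vparts t
  | (_, Var _) => 2
  | _ => 0
  end.

Definition subst_eq (F : Type) (th : nat -> term F) (e : equation F) :
  equation F := (subst th e.1, subst th e.2).

Definition slack (F : eqType) (D : nat) (T : seq (term F)) : nat :=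
  \sum_(u <- T) (D - depth u).

(* The multiset of the depths of the equations is encoded by the numbers of   *)
(* equations of depth D, D - 1, ..., 0, where D = size T bounds all depths.   *)
Definition measure (F : eqType) (T : seq (term F)) (E : seq (equation F)) :
    seq nat :=
  slack (size T) T ::
  [seq count_mem (size T - i) (map (@edepth F) E) | i <- iota 0 (size T).+1]
  ++ [:: \sum_(e <- E) flag e].

(** Depths never drop under substitution and [D] caps them, so a single strict growth lowers the
    sum. *)
Lemma slack_subst (F : eqType) D (T : seq (term F)) th :
  (forall u, u \in T -> depth (subst th u) <= D) ->
  (forall u, u \in T -> depth (subst th u) = depth u) \/
  slack D (map (subst th) T) < slack D T.
Proof.
move=> leD; case: (boolP (all (fun u => depth (subst th u) == depth u) T)).
  by move=> /allP eqT; left => u /eqT/eqP.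
case/allPn => u uT du; right; rewrite /slack big_map !(big_rem u uT) /=.
rewrite -addSn; apply: leq_add; last first.
  by apply: leq_sum => w _; apply: leq_sub2l; apply: depth_subst.
have lt_u : depth u < depth (subst th u).
  by rewrite ltn_neqAle eq_sym du depth_subst.
by apply: ltn_sub2l => //; apply: leq_trans lt_u (leD u uT).
Qed.

(** If the slack falls, the head entry decides whatever the equations become. Otherwise the counts
    above the depth of [e] agree and the count at that depth drops by one. *)
Lemma lexlt_measure (F : eqType) (T : seq (term F)) th p e q C :
  (forall u, u \in T -> depth (subst th u) <= size T) ->
  edepth e <= size T ->
  ((forall u, u \in T -> depth (subst th u) = depth u) ->
   (forall e', e' \in p ++ q -> edepth (subst_eq th e') = edepth e') /\
   (forall c, c \in C -> edepth c < edepth e)) ->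
  lexlt (measure (map (subst th) T) (C ++ map (subst_eq th) (p ++ q)))
        (measure T (p ++ e :: q)).
Proof.
move=> leD le_e; rewrite /measure size_map.
case: (slack_subst leD) => [eqT /(_ eqT)[eqE ltC]|lt_slack _]; last first.
  by rewrite /= lt_slack !size_cat !size_map /= eqxx.
have -> : slack (size T) (map (subst th) T) = slack (size T) T.
  by rewrite /slack big_map; apply: eq_big_seq => u /eqT->.
apply: (@lexlt_cat2l [:: _]).
set d := edepth e in le_e ltC *; set D := size T in le_e *.
(* Entry [D - d] counts the equations of depth [d]; earlier entries count deeper ones. *)
have -> : iota 0 D.+1 = iota 0 (D - d) ++ (D - d) :: iota (D - d).+1 d.
  by rewrite -[RHS]/(_ ++ iota (0 + (D - d)) d.+1) -iotaD addnS subnK.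
have cntE k : count_mem k (map (@edepth F) (p ++ e :: q)) =
    (d == k) + count_mem k (map (@edepth F) (p ++ q)).
  by rewrite !map_cat !count_cat /= addnCA.
have cntC k : d <= k ->
    count_mem k (map (@edepth F) (C ++ map (subst_eq th) (p ++ q))) =
    count_mem k (map (@edepth F) (p ++ q)).
  move=> dk; rewrite map_cat count_cat -map_comp.
  rewrite -[RHS]add0n; congr (_ + _); last first.
    by congr count; apply/eq_in_map => e' /eqE.
  apply/eqP; rewrite -leqn0 leqNgt -has_count; apply/hasPn => _ /mapP[c cC ->].
  by rewrite /= neq_ltn (leq_trans (ltC c cC) dk).
apply: lexlt_map => // [i|]; last by rewrite subKn // cntE cntC // eqxx.
rewrite mem_iota add0n => /andP[_ lt_i].
have lt_d : d < D - i by rewrite ltn_subRL addnC -ltn_subRL.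
by rewrite cntE cntC ?(ltnW lt_d) // (ltn_eqF lt_d).
Qed.

Lemma lexlt_measure_flag (F : eqType) (T : seq (term F)) p e e' q :
  edepth e' = edepth e -> flag e' < flag e ->
  lexlt (measure T (e' :: p ++ q)) (measure T (p ++ e :: q)).
Proof.
move=> de fe; have sumE : \sum_(x <- p ++ e :: q) flag x =
    flag e + \sum_(x <- p ++ q) flag x by rewrite !big_cat big_cons addnCA.
have cntE i : count_mem (size T - i) (map (@edepth F) (e' :: p ++ q)) =
    count_mem (size T - i) (map (@edepth F) (p ++ e :: q)).
  by rewrite /= !map_cat !count_cat /= de addnCA.
rewrite /measure (eq_map cntE) sumE big_cons -!cat_cons.
by apply: lexlt_cat2l; rewrite /= ltn_add2r fe.
Qed.

(** * The loop invariant *)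

Definition fixes (F : Type) (th : nat -> term F) (Ns : seq nat) : Prop :=
  forall N, N \in Ns -> th N = Var N.

(* An equation is annotated with the variables introduced in it by the        *)
(* removal rule, which no other equation contains; its depth is that of a     *)
(* pair of terms of T, as long as these variables are not bound.              *)
Definition tracked (F : eqType) (T : seq (term F)) (g : equation F * seq nat) :
    Prop :=
  exists s t, [/\ s \in T, t \in T
    & forall th, fixes th g.2 ->
        edepth (subst_eq th g.1) = maxn (depth (subst th s)) (depth (subst th t))].

Definition avoids (F : eqType) (g h : equation F * seq nat) : bool :=
  all (fun N => N \notin equation_vars h.1) g.2.

(** Two-sided, since either equation may be selected first, and eliminating its variables must not
    bind annotations of the other. *)
Definition apart (F : eqType) (g h : equation F * seq nat) : bool :=
  avoids g h && avoids h g.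

Definition equation_inv (F : eqType) (U : seq nat) (T : seq (term F))
    (g : equation F * seq nat) : Prop :=
  [/\ covered T g.1.1, covered T g.1.2, tracked T g,
      {subset equation_vars g.1 <= U} & {subset g.2 <= U}].

(** [Emp] is kept in [T] because propagation may bind to it and removing [X] may leave an empty
    union. *)
Definition loop_inv (F : eqType) (U : seq nat) (T : seq (term F))
    (G : seq (equation F * seq nat)) : Prop :=
  [/\ Emp \in T, node_closed T, forall g, g \in G -> equation_inv U T g
    & pairwise (@apart F) G].

Lemma inv_focus (F : eqType) U (T : seq (term F)) p g q :
  loop_inv U T (p ++ g :: q) ->
  [/\ equation_inv U T g, loop_inv U T (p ++ q)
    & forall h, h \in p ++ q -> apart g h].
Proof.
case=> eT clT gi; have perm_g : perm_eq (p ++ g :: q) (g :: p ++ q).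
  by rewrite -cat1s perm_catCA.
rewrite !pairwise_cat allrel_consr pairwise_cons.
case/and3P=> /andP[/allP pg pq] pp /andP[/allP gq qq]; split.
- by apply: gi; rewrite (perm_mem perm_g) mem_head.
- split=> // [h hpq|]; last by rewrite pairwise_cat pq pp.
  by apply: gi; rewrite (perm_mem perm_g) inE hpq orbT.
by move=> h; rewrite mem_cat => /orP[/pg|/gq]; rewrite // /apart andbC.
Qed.

Lemma subst_Var (F : eqType) (t : term F) : subst Var t = t.
Proof. exact: subst_fixed. Qed.

Lemma tracked_edepth (F : eqType) (T : seq (term F)) g :
  tracked T g ->
  exists s t, [/\ s \in T, t \in T & edepth g.1 = maxn (depth s) (depth t)].
Proof.
case=> s [t [sT tT /(_ Var)]]; rewrite /subst_eq !subst_Var -surjective_pairing.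
by move=> H; exists s, t; split=> //; apply: H.
Qed.

Lemma tracked_subst (F : eqType) (T : seq (term F)) g th :
  fixes th g.2 -> tracked T g ->
  tracked (map (subst th) T) (subst_eq th g.1, g.2).
Proof.
move=> fth [s [t [sT tT H]]]; exists (subst th s), (subst th t).
split; [exact: map_f | exact: map_f |] => ta fta.
rewrite /= !subst_comp -H; last by move=> N Ng; rewrite fth //=; apply: fta.
by rewrite /subst_eq /= !subst_comp.
Qed.

Lemma tracked_subst_edepth (F : eqType) (T : seq (term F)) g th :
  fixes th g.2 -> tracked T g ->
  (forall u, u \in T -> depth (subst th u) = depth u) ->
  edepth (subst_eq th g.1) = edepth g.1.
Proof.
move=> fth [s [t [sT tT H]]] eqT; rewrite (H th fth) !eqT //.
have := H Var; rewrite /subst_eq !subst_Var -surjective_pairing => ->; exact.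
Qed.

Lemma tracked_self (F : eqType) (T : seq (term F)) (e : equation F) :
  e.1 \in T -> e.2 \in T -> tracked T (e, [::]).
Proof. by move=> e1 e2; exists e.1, e.2. Qed.

Lemma vars_subst_eq (F : eqType) (b : nat -> term F) o e x :
  x \in equation_vars (subst_eq (compose b o) e) ->
  x \in equation_vars e \/ exists2 X, X \in o & x \in vars (b X).
Proof.
rewrite !mem_cat => /orP[] /vars_compose[->|]; rewrite ?orbT; by [left | right].
Qed.

Lemma inv_eliminate (F : eqType) U V (T : seq (term F)) p g q b o C :
  loop_inv U T (p ++ g :: q) ->
  triangular T b o ->
  {subset o <= equation_vars g.1} ->
  (forall X x, X \in o -> x \in vars (b X) ->
     (x \in equation_vars g.1) || (x \in V)) ->
  (forall x, x \in V -> x \notin U) ->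
  (forall c : equation F, c \in C ->
     [/\ c.1 \in T, c.2 \in T, edepth c < edepth g.1
       & {subset equation_vars c <= equation_vars g.1}]) ->
  exists T' G',
    [/\ map fst G' = subst_equations (compose b o) (C ++ map fst (p ++ q)),
        loop_inv (V ++ U) T' G'
      & lexlt (measure T' (map fst G')) (measure T (map fst (p ++ g :: q)))].
Proof.
move=> invG tri o_e bV VU HC; set th := compose b o.
have [[_ _ trg gU _] [eT clT ipq pwpq] gpq] := inv_focus invG.
have clT' := closed_compose tri clT; rewrite -/th in clT'.
pose T' := map (subst th) T.
pose G' := [seq (subst_eq th c, [::]) | c <- C] ++
           [seq (subst_eq th h.1, h.2) | h <- p ++ q].
have avoid h N : h \in p ++ q -> N \in h.2 -> N \notin equation_vars g.1.
  by move=> /gpq/andP[_ /allP]; apply.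
have fix_h h : h \in p ++ q -> fixes th h.2.
  move=> hpq N Nh; apply: compose_fixed; apply: contra (avoid h N hpq Nh).
  exact: o_e.
have varsV e x : {subset equation_vars e <= U} ->
    x \in equation_vars (subst_eq th e) -> x \in V ++ U.
  move=> eU /vars_subst_eq[/eU xU|[X Xo /(bV X x Xo)]]; rewrite mem_cat.
    by rewrite xU orbT.
  by case/orP=> [/gU->|->]; rewrite ?orbT.
(* A binding cannot bring in an annotation: its variables are in [g.1], which the annotation avoids,
   or in [V], disjoint from [U]. *)
have avoidS h N e : h \in p ++ q -> N \in h.2 -> N \notin equation_vars e ->
    N \notin equation_vars (subst_eq th e).
  move=> hpq Nh Ne; apply/negP => /vars_subst_eq[|[X Xo /(bV X N Xo)]].
    by apply/negP.
  rewrite (negbTE (avoid h N hpq Nh)) /= => /VU.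
  by case: (ipq h hpq) => _ _ _ _ /(_ N Nh)->.
have mapG' : map fst G' = subst_equations th (C ++ map fst (p ++ q)).
  by rewrite /G' /subst_equations !map_cat -!map_comp.
exists T', G'; split=> //.
- split=> // [|g'|].
  + by apply/mapP; exists Emp.
  + rewrite mem_cat => /orP[] /mapP[h hG ->].
      have [h1 h2 _ hg] := HC h hG; split=> //=; try exact/covered_compose/clT.
        by apply: tracked_self; apply: map_f.
      by move=> x; apply: varsV => y /hg/gU.
    have [c1 c2 trh hU NU] := ipq h hG; split; try exact: covered_compose.
    * exact: tracked_subst (fix_h h hG) trh.
    * by move=> x; apply: varsV.
    by move=> N /NU; rewrite mem_cat orbC => ->.
  rewrite pairwise_cat; apply/and3P; split.
  + apply/allrelP => _ _ /mapP[c cC ->] /mapP[h hpq ->]; apply/andP; split=> //.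
    apply/allP => N Nh; apply: (avoidS h) => //; apply: contra (avoid h N hpq Nh).
    by have [_ _ _] := HC c cC; apply.
  + by rewrite pairwise_map; elim: (C) => //= c C' ->; rewrite andbT; apply/allP.
  rewrite pairwise_map; apply: sub_in_pairwise pwpq; last exact: allss.
  move=> h h' hpq hpq' /andP[/allP a1 /allP a2].
  by apply/andP; split; apply/allP => N Nh; [apply: (avoidS h) | apply: (avoidS h')];
    rewrite ?a1 ?a2.
rewrite mapG' (map_cat fst p q) (map_cat fst p (g :: q)) map_cons.
rewrite /subst_equations (map_cat _ C).
have [s [t [sT tT dg]]] := tracked_edepth trg.
apply: lexlt_measure.
(* The instantiated list is closed again and has the same length, so [size T] still bounds its
   depths. *)
- by move=> u uT; rewrite -(size_map (subst th)) closed_depth ?map_f.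
- by rewrite dg geq_max !closed_depth.
move=> eqT; split=> [e'|_ /mapP[c /HC[c1 c2 ltc _] ->]].
  rewrite -map_cat => /mapP[h hpq ->]; apply: (@tracked_subst_edepth _ T) => //.
    exact: fix_h.
  by case: (ipq h hpq).
by rewrite /edepth /= !eqT.
Qed.

(** For rules that bind nothing: [T] is kept, and at equal depth the flag decides. *)
Lemma inv_rework (F : eqType) U U' (T : seq (term F)) p g q g' :
  loop_inv U T (p ++ g :: q) -> {subset U <= U'} ->
  equation_inv U' T g' -> (forall h, h \in p ++ q -> apart g' h) ->
  edepth g'.1 = edepth g.1 -> flag g'.1 < flag g.1 ->
  exists T' G',
    [/\ map fst G' = g'.1 :: map fst (p ++ q), loop_inv U' T' G'
      & lexlt (measure T' (map fst G')) (measure T (map fst (p ++ g :: q)))].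
Proof.
move=> invG UU' ig' ag' dg fg; have [_ [eT clT ipq pwpq] _] := inv_focus invG.
exists T, (g' :: p ++ q); split=> //; last first.
  rewrite map_cons (map_cat fst p q) (map_cat fst p (g :: q)) map_cons.
  exact: lexlt_measure_flag.
split=> // [h|]; last by rewrite pairwise_cons pwpq andbT; apply/allP.
rewrite inE => /orP[/eqP-> //|/ipq[h1 h2 h3 h4 h5]].
by split=> // x; [move/h4/UU' | move/h5/UU'].
Qed.

(** * Preservation of the invariant by the rules *)

Lemma map_eq_cat_cons (A B : Type) (f : A -> B) s p y q :
  map f s = p ++ y :: q ->
  exists p' x q', [/\ s = p' ++ x :: q', map f p' = p, f x = y & map f q' = q].
Proof.
elim: p s => [|z p IH] [|x s] //= [fx fs]; first by exists [::], x, s.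
have [p' [x' [q' [-> <- fx' <-]]]] := IH s fs.
by exists (x :: p'), x', q'; rewrite /= fx.
Qed.

Lemma mem_zip (A B : eqType) (s : seq A) (t : seq B) x :
  x \in zip s t -> x.1 \in s /\ x.2 \in t.
Proof.
elim: s t => [|a s IH] [|b t] //; rewrite [zip _ _]/= in_cons.
case/orP=> [/eqP->|/IH[xs xt]].
  by split; apply: mem_head.
by split; apply/orP; right.
Qed.

Lemma subst_equations_nil (F : eqType) (b : nat -> term F) E :
  subst_equations (compose b [::]) E = E.
Proof.
by apply: map_id_in => -[s t] _; rewrite /= !subst_compose_nil.
Qed.

Lemma first_lhs_mem (F : eqType) (s t : term F) NL NR mu A :
  let u := first_lhs (aci_eqs2 s t NL NR mu) A in
  u = Emp \/ u \in fparts s ++ fparts t.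
Proof.
rewrite /first_lhs /aci_eqs2 /=; set eqs := zip _ _; set i := find _ _.
case: (ltnP i (size eqs)) => [lti|lei]; last by left; rewrite nth_default.
by right; have /mem_zip[] := mem_nth (Emp, [::]) lti.
Qed.

Lemma fparts_equation (F : eqType) (e : equation F) u :
  u \in fparts e.1 ++ fparts e.2 -> u \in nodes e.1 ++ nodes e.2.
Proof. by rewrite !mem_cat => /orP[]/fparts_nodes->; rewrite ?orbT. Qed.

Lemma vars_equation_node (F : eqType) (e : equation F) u :
  u \in nodes e.1 ++ nodes e.2 -> {subset vars u <= equation_vars e}.
Proof.
by rewrite mem_cat => /orP[]/vars_nodes H x /H; rewrite mem_cat => ->; rewrite ?orbT.
Qed.

Lemma args_equation_node (F : eqType) (e : equation F) u a :
  u \in nodes e.1 ++ nodes e.2 -> a \in args u ->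
  depth a < edepth e /\ {subset vars a <= equation_vars e}.
Proof.
rewrite mem_cat leq_max => /orP[] ue ua; rewrite (depth_node_arg ue ua) ?orbT.
  by split=> // x /(vars_node_arg ue ua); rewrite mem_cat => ->.
by split=> // x /(vars_node_arg ue ua); rewrite mem_cat => ->; rewrite orbT.
Qed.

Lemma covered_equation_node (F : eqType) (T : seq (term F)) (e : equation F) u :
  covered T e.1 -> covered T e.2 -> u \in nodes e.1 ++ nodes e.2 ->
  u \in T /\ {subset args u <= T}.
Proof. by move=> c1 c2; rewrite mem_cat => /orP[/c1|/c2]. Qed.

(** Serves both free decomposition, where [u] and [v] are the two sides, and the ACI step, where
    they are components. *)
Lemma decompose_child (F : eqType) (T : seq (term F)) (e c : equation F) u v :
  covered T e.1 -> covered T e.2 ->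
  u \in nodes e.1 ++ nodes e.2 -> v \in nodes e.1 ++ nodes e.2 ->
  c \in zip (args u) (args v) ->
  [/\ c.1 \in T, c.2 \in T, edepth c < edepth e
    & {subset equation_vars c <= equation_vars e}].
Proof.
move=> c1 c2 un vn /mem_zip[cu cv].
have [_ uT] := covered_equation_node c1 c2 un.
have [_ vT] := covered_equation_node c1 c2 vn.
have [du su] := args_equation_node un cu; have [dv sv] := args_equation_node vn cv.
split; [exact: uT | exact: vT | by rewrite gtn_max du dv |].
by move=> x; rewrite mem_cat => /orP[/su|/sv].
Qed.

(** Each [A] ends as itself, [Emp] or a component of the equation ([lamP]). Bindings are thus unions
    of fresh variables and terms covered by [T], and children pair arguments of two components. *)
Lemma loop_inv_aci (F : eqType) U (T : seq (term F)) p g q s t V E1 E2 th :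
  loop_inv U T (p ++ g :: q) -> g.1 = (s, t) ->
  aci_step U s t (AciDone V E1 E2 th) ->
  exists T' G',
    [/\ map fst G' = E2 ++ subst_equations th (map fst (p ++ q)),
        loop_inv (V ++ U) T' G'
      & lexlt (measure T' (map fst G')) (measure T (map fst (p ++ g :: q)))].
Proof.
move=> invG gE stp; have [[cs ct _ gU _] [eT clT _ _] _] := inv_focus invG.
move def_r : (AciDone V E1 E2 th) stp => r stp.
case: stp def_r => // NL NR mu lam o sol prop acc acyc perm_o pw_o /= [-> _ -> ->].
rewrite /subst_equations -map_cat -/(subst_equations _ _).
have nodeP u : u \in fparts s ++ fparts t -> u \in nodes g.1.1 ++ nodes g.1.2.
  by move=> us; apply: fparts_equation; rewrite gE.
case: sol => szL szR [_ newN] _ newA.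
have lamP A : lam A = Var A \/ lam A = Emp \/ lam A \in fparts s ++ fparts t.
  move: (prop A); case: ifP => _ [] ->; [by right; left | | by left].
  by right; apply: first_lhs_mem.
have o_top X : (X \in o) = (X \in vparts s ++ vparts t).
  by rewrite (perm_mem perm_o) mem_undup.
have o_all X : X \in o -> X \in (NL ++ vparts s) ++ (NR ++ vparts t).
  by rewrite o_top !mem_cat => /orP[]->; rewrite ?orbT.
have mem_b X A : X \in o -> A \in mu X -> A \in new_vars s t NL NR mu.
  move=> /o_all Xall AX; rewrite 2!mem_cat; apply/orP; right; apply/orP; right.
  by apply/flatten_mapP; exists X.
apply: (inv_eliminate invG).
- split.
  + apply: sub_in_pairwise pw_o; last exact: allss.
    move=> X Y _ Yo; rewrite /depends mem_undup -o_top.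
    by rewrite (_ : Y \in o).
  (* A variable in its own binding would be a cycle of length one. *)
  + move=> X Xo; apply/negP => XbX; apply: acyc; exists X, [::].
    by rewrite /= /depends mem_undup -o_top Xo XbX.
  move=> X Xo v; rewrite binding_cupl => /nodes_cupl[->|[_ /mapP[A _ ->]]].
    by [].
  case: (lamP A) => [->|[->|/nodeP lamA]] //; first exact: clT.
  by have [lT _] := covered_equation_node cs ct lamA; apply: clT.
- move=> X; rewrite o_top gE !mem_cat => /orP[]/vparts_vars->; by rewrite ?orbT.
- move=> X x Xo; rewrite binding_cupl => /vars_cupl[_ /mapP[A AX ->]].
  case: (lamP A) => [->|[->|/nodeP lamA]] //.
    by rewrite inE => /eqP->; rewrite (mem_b X A) ?orbT.
  by move/(vars_equation_node lamA)->.
- move=> x; rewrite /new_vars catA mem_cat => /orP[/newN //|].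
  case/flatten_mapP=> X Xall /(newA X x Xall).
  by rewrite mem_cat negb_or => /andP[].
move=> c /flatten_mapP[e /mem_zip[/nodeP e1 _] /flatten_mapP[u ur c_eu]].
apply: (decompose_child cs ct e1 _ c_eu).
have : u = Emp \/ exists2 A, A \in e.2 & u = lam A.
  move: ur; rewrite /reduce; case E: (undup _) => [|w us].
    by rewrite inE => /eqP->; left.
  rewrite -E mem_undup mem_filter => /andP[_ /mapP[A Ae ->]].
  by right; exists A.
(* The child [c] comes from a zip of arguments, so [u] has some; this excludes [Emp] and
   variables. *)
have noargs w : args w = [::] -> u = w -> False.
  by move=> aw uw; move: c_eu; rewrite uw aw => /mem_zip[].
case=> [uE|[A Ae uE]]; first by case: (noargs Emp).
case: (lamP A) => [lA|[lA|/nodeP]]; last by rewrite uE.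
  by case: (noargs (Var A)); rewrite // uE.
by case: (noargs Emp); rewrite // uE.
Qed.

(** The dropped occurrences of [X] still count through the left-hand side, and [N], left unbound,
    has depth 0. *)
Lemma depth_remove (F : eqType) (th : nat -> term F) X N t :
  X \in vparts t -> th N = Var N ->
  let t' := cupl (fparts t ++ [seq Var V | V <- vparts t & V != X]) in
  edepth (subst_eq th (Var X, Cup t' (Var N))) = edepth (subst_eq th (Var X, t)).
Proof.
move=> Xt thN t'; rewrite /edepth /subst_eq [subst th (Cup _ _)]/= depth_Cup thN.
rewrite maxn0 /t' depth_subst_cupl (depth_subst_comps _ t) /=.
apply/eqP; rewrite eqn_leq !geq_max !leq_maxl /=; apply/andP; split.
  apply/bigmax_leqP_seq => u; rewrite mem_cat => ut _; rewrite leq_max orbC.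
  suff u_t : u \in comps t by rewrite (@leq_bigmax_seq _ _ _ (fun u => depth _)).
  case/orP: ut => [|/mapP[V]]; first by rewrite mem_filter => /andP[].
  by rewrite mem_filter mem_vparts => /andP[_ ?] ->.
apply/bigmax_leqP_seq => u ut _; rewrite leq_max.
case: (u =P Var X) => [->|uX]; first by rewrite leqnn.
rewrite (@leq_bigmax_seq _ _ _ (fun u => depth _)) ?orbT //.
rewrite mem_cat mem_filter ut andbT; case: u ut uX => [V|//] ut uX /=.
apply: map_f; rewrite mem_filter mem_vparts ut andbT.
by apply/eqP => VX; rewrite VX in uX.
Qed.

(** The new [N] joins the annotation, and freshness keeps it out of all other equations. The flag
    drops from 1 to 0, as [X] is gone from the right-hand side. *)
Lemma loop_inv_remove (F : eqType) U (T : seq (term F)) p g q X t N :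
  loop_inv U T (p ++ g :: q) -> g.1 = (Var X, t) ->
  ~~ is_var t -> X \in vparts t ->
  X \notin flatten (map (@vars F) (fparts t)) -> N \notin U ->
  let t' := cupl (fparts t ++ [seq Var V | V <- vparts t & V != X]) in
  exists T' G',
    [/\ map fst G' = (Var X, Cup t' (Var N)) :: map fst (p ++ q),
        loop_inv (N :: U) T' G'
      & lexlt (measure T' (map fst G')) (measure T (map fst (p ++ g :: q)))].
Proof.
move=> invG gE tNv Xt Xf NU t'.
have [[cX ct trg gU NsU] [eT clT ipq _] gpq] := inv_focus invG.
rewrite gE /= in ct.
have t'P u : u \in fparts t ++ [seq Var V | V <- vparts t & V != X] -> u \in comps t.
  rewrite mem_cat => /orP[|/mapP[V]]; first by rewrite mem_filter => /andP[].
  by rewrite mem_filter mem_vparts => /andP[_ ?] ->.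
have vt' : {subset vars t' <= vars t}.
  by move=> x /vars_cupl[u /t'P/comps_sub[_ ut]] /ut.
have gvars x : x \in vars t -> x \in equation_vars g.1.
  by rewrite gE mem_cat => ->; rewrite orbT.
have XU : X \in U by apply: gU; rewrite gE mem_cat inE eqxx.
have vg' x : x \in equation_vars (Var X, Cup t' (Var N)) ->
    x \in N :: equation_vars g.1.
  rewrite mem_cat !inE => /orP[/eqP->|].
    by rewrite gE mem_cat inE eqxx orbT.
  rewrite /= mem_cat inE => /orP[/vt'/gvars->|->//]; by rewrite orbT.
have NX : N != X by apply: contraNneq NU => ->.
have Xt' : X \notin vars t'.
  apply/negP => /vars_cupl[u]; rewrite mem_cat => /orP[uf Xu|/mapP[V]].
    by case/negP: Xf; apply/flatten_mapP; exists u.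
  by rewrite mem_filter => /andP[VX _] ->; rewrite inE eq_sym (negbTE VX).
apply: (@inv_rework _ U (N :: U) T p g q ((Var X, Cup t' (Var N)), N :: g.2)) => //.
- by move=> x xU; rewrite inE xU orbT.
- split=> //=.
  + move=> v /mem_nodes_App[[//]|[a]]; rewrite !inE => /orP[]/eqP->//.
    case/nodes_cupl=> [->|[u /t'P/comps_sub[ut _]] /ut/ct //].
    by split.
  + have [s0 [t0 [sT tT H]]] := trg; exists s0, t0; split=> // th fth.
    rewrite depth_remove -?H ?gE //; last by apply: fth; rewrite mem_head.
    by move=> M Mg; apply: fth; rewrite inE Mg orbT.
  + by move=> x /vg'; rewrite !inE => /orP[->//|/gU->]; rewrite orbT.
  by move=> x; rewrite !inE => /orP[->//|/NsU->]; rewrite orbT.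
- move=> h hpq; have /andP[/allP gh /allP hg] := gpq h hpq.
  have [_ _ _ hU NhU] := ipq h hpq; apply/andP; split; apply/allP => M.
    by rewrite inE => /orP[/eqP->|/gh//]; apply: contra NU => /hU.
  move=> Mh; apply/negP => /vg'; rewrite inE => /orP[/eqP MN|].
    by rewrite -MN (NhU M Mh) in NU.
  by apply/negP; apply: hg.
- rewrite gE; have := depth_remove (th := Var) Xt (erefl (Var N)).
  by rewrite /subst_eq !subst_Var.
have flagE u : ~~ is_var u -> flag (Var X, u) = (X \in vparts u) by case: u.
rewrite gE !flagE // Xt (contraNF (@vparts_vars _ _ X)) //.
by rewrite [vars _]/= mem_cat negb_or Xt' inE eq_sym.
Qed.

Lemma loop_inv_step (F : eqType) U Es (T : seq (term F)) G U' Es' Ens' :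
  loop_inv U T G ->
  general_aci_step (Run U Es (map fst G)) (Run U' Es' Ens') ->
  exists T' G',
    [/\ map fst G' = Ens', loop_inv U' T' G'
      & lexlt (measure T' (map fst G')) (measure T (map fst G))].
Proof.
move=> invG stp; move def_c : (Run U Es _) stp => c stp.
move def_c' : (Run U' Es' Ens') stp => c' stp.
case: stp def_c def_c' => {c c'} U0 Es0 P e Q c hdl [eU eEs eG].
rewrite -{}eU -{}eEs in hdl => def_c.
have [p [g [q [defG eP ge eQ]]]] := map_eq_cat_cons eG.
rewrite -{}eP -{}eQ -map_cat in hdl; rewrite {}defG in invG *.
have [[c1 c2 trg gU NsU] [eT clT ipq _] gpq] := inv_focus invG.
(* With an empty [o] nothing is eliminated and the substitution is the identity. *)
have elim0 C : (forall c : equation F, c \in C ->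
      [/\ c.1 \in T, c.2 \in T, edepth c < edepth g.1
        & {subset equation_vars c <= equation_vars g.1}]) ->
    exists T' G',
    [/\ map fst G' = C ++ map fst (p ++ q), loop_inv U T' G'
      & lexlt (measure T' (map fst G')) (measure T (map fst (p ++ g :: q)))].
  move=> HC; have tri0 : triangular T Var [::] by [].
  have := @inv_eliminate _ U [::] T p g q Var [::] C invG tri0.
  by rewrite subst_equations_nil; apply.
case: hdl ge def_c => //.
- by move=> X _ [-> _ ->]; apply: (elim0 [::]).
- move=> t X tNv ge [-> _ ->].
  apply: (@inv_rework _ U U T p g q ((Var X, t), g.2)) => //.
  + rewrite ge in c1 c2 gU; split=> //=.
    * have [s0 [t0 [sT tT H]]] := trg; exists s0, t0; split=> // th fth.
      by rewrite -H // ge [RHS]maxnC.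
    * by move=> x xe; apply: gU; move: xe; rewrite !mem_cat orbC.
  + move=> h hpq; have /andP[gh /allP hg] := gpq h hpq.
    apply/andP; split=> //; apply/allP => N /hg.
    by rewrite ge !mem_cat orbC.
  + by rewrite ge /edepth maxnC.
  (* The flag drops from 2 to at most 1, leaving room for a later removal. *)
  rewrite ge; case: t tNv {ge} => // f ts _.
  by rewrite /= ltnS leq_b1.
- move=> X t Xt ge [-> _ ->].
  (* Composing over the one-element list [[:: X]] computes to [single X t]. *)
  have := @inv_eliminate _ U [::] T p g q (fun _ => t) [:: X] [::] invG.
  rewrite cat0s; apply=> //.
  + split=> //; first by move=> Y; rewrite inE => /eqP->.
    by move=> Y _; rewrite ge in c2.
  + by move=> Y; rewrite inE => /eqP->; rewrite ge mem_cat inE eqxx.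
  by move=> _ x _ xt; rewrite ge !mem_cat xt orbT.
- move=> X t N tNv Xt Xf NU /= ge [-> _ ->].
  exact: loop_inv_remove ge tNv Xt Xf NU.
- move=> f ss ts fU ge [-> _ ->]; apply: elim0 => e0 e0z.
  apply: (@decompose_child _ T g.1 e0 (App f ss) (App f ts)) => //; rewrite ge mem_cat.
    by case: f fU {ge} => [||f] //= _; rewrite inE eqxx.
  by case: f fU {ge} => [||f] //= _; rewrite orbC inE eqxx.
move=> s1 s2 t1 t2 V E1 E2 th stp ge [-> _ ->].
exact: loop_inv_aci ge stp.
Qed.

(** * The initial system and termination *)

Fixpoint subterms (F : Type) (t : term F) : seq (term F) :=
  t :: (if t is App _ ts then flatten (map (@subterms F) ts) else [::]).

Lemma subterms_refl (F : eqType) (t : term F) : t \in subterms t.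
Proof. by case: t => *; rewrite mem_head. Qed.

Lemma subterms_arg (F : eqType) (f : sym F) ts a :
  a \in ts -> {subset subterms a <= subterms (App f ts)}.
Proof.
move=> a_ts v va; rewrite inE; apply/orP; right.
by apply/flatten_mapP; exists a.
Qed.

Lemma subterms_trans (F : eqType) (t u : term F) :
  u \in subterms t -> {subset subterms u <= subterms t}.
Proof.
elim/term_seq_ind: t => [x|f ts IH]; first by rewrite inE => /eqP->.
rewrite inE => /orP[/eqP-> //|/flatten_mapP[a a_ts /(IH a a_ts) sub] v /sub].
exact: subterms_arg.
Qed.

Lemma subterms_nodes (F : eqType) (t v : term F) :
  v \in nodes t -> v \in subterms t /\ {subset args v <= subterms t}.
Proof.
elim/term_seq_ind: t => // f ts IH /mem_nodes_App[[_ ->]|[a a_ts]].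
  split=> [|a a_ts]; first exact: subterms_refl.
  exact: subterms_arg a_ts _ (subterms_refl a).
move/(IH a a_ts) => [va av].
split=> [|w /av wa]; first exact: subterms_arg a_ts _ va.
exact: subterms_arg a_ts _ wa.
Qed.

Lemma loop_inv_init (F : eqType) (E : seq (equation F)) :
  loop_inv (flatten (map (@equation_vars F) E))
    (Emp :: flatten [seq subterms e.1 ++ subterms e.2 | e <- E])
    [seq (e, [::]) | e <- E].
Proof.
set T := Emp :: _.
have clT : node_closed T.
  move=> u; rewrite inE => /orP[/eqP-> v|].
    by rewrite inE => /eqP->; rewrite mem_head.
  case/flatten_mapP=> e eE ue v /subterms_nodes[vu av].
  have sub : {subset subterms u <= T}.
    move=> w wu; rewrite inE; apply/orP; right; apply/flatten_mapP; exists e => //.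
    move: ue; rewrite !mem_cat => /orP[]/subterms_trans->//; by rewrite orbT.
  by split=> [|w /av wu]; apply: sub.
have ET e : e \in E -> e.1 \in T /\ e.2 \in T.
  by move=> eE; split; rewrite inE; apply/orP; right; apply/flatten_mapP;
    exists e; rewrite // mem_cat subterms_refl ?orbT.
split=> [|//|_ /mapP[e eE ->]|]; first exact: mem_head; last first.
  by rewrite pairwise_map; elim: E {T clT ET} => //= e E ->; rewrite andbT; apply/allP.
have [e1 e2] := ET e eE; split=> //=; try exact: clT.
  exact: tracked_self.
by move=> x xe; apply/flatten_mapP; exists e.
Qed.

Theorem theoremA7 (F : eqType) (ar : F -> nat) (E : seq (equation F))
  (wfE : all (wf_equation ar) E) :
  ~ (exists c : nat -> config F, infinite_branch E c).
Proof.
case=> c [c0 stp].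
have loop m : Acc lexlt m -> forall n U Es T G,
    c n = Run U Es (map fst G) -> loop_inv U T G -> measure T (map fst G) = m ->
    False.
  elim=> {}m _ IH n U Es T G cn invG mE; move: (stp n); rewrite cn.
  (* A failed configuration has no successor, so an infinite branch never reaches one. *)
  case cn1: (c n.+1) => [|U' Es' Ens'].
    by move=> _; move: (stp n.+1); rewrite cn1 => h; inversion h.
  case/(loop_inv_step invG) => T' [G' [GE invG' lt]].
  apply: (IH _ _ n.+1 U' Es' T' G') => //; first by rewrite -mE; exact: lt.
  by rewrite cn1 GE.
have initE : map fst [seq (e, [::] : seq nat) | e <- E] = E.
  by rewrite -map_comp map_id.
apply: (loop _ (lexlt_wf _) 0 _ [::] _ _ _ (loop_inv_init E) (erefl _)).
by rewrite c0 initE.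
Qed.
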